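(* Let $a,b,c$ be real numbers, let $\epsilon_{i,j}$, $i,j\in\mathbb{Z}$, be uncorrelated random variables with zero mean and equal variance $\sigma_\epsilon^2\in(0,\infty)$, let $X=\{X_{i,j},\ i,j\in\mathbb{Z}\}$ be a wide-sense stationary field satisfying $$X_{i,j}=aX_{i-1,j}+bX_{i,j-1}+cX_{i-1,j-1}+\epsilon_{i,j}\qquad\text{for all } i,j\in\mathbb{Z},$$ and let $\gamma_X(h_1,h_2)$ be the autocovariance function of $X$. Let $h_1,h_2$ be integers. Then the equality $$\gamma_X(h_1,h_2)=a\gamma_X(h_1-1,h_2)+b\gamma_X(h_1,h_2-1)+c\gamma_X(h_1-1,h_2-1)$$ holds if any of the following conditions holds: (1) $h_1\ge1$, $(1-a-b-c)(1+a-b+c)>0$ and $(1-a+b+c)(1+a+b-c)>0$; (2) $h_1\le0$, $(1-a-b-c)(1+a-b+c)<0$ and $(1-a+b+c)(1+a+b-c)<0$; (3) $h_2\ge1$, $(1-a-b-c)(1-a+b+c)>0$ and $(1+a-b+c)(1+a+b-c)>0$; (4) $h_2\le0$, $(1-a-b-c)(1-a+b+c)<0$ and $(1+a-b+c)(1+a+b-c)<0$.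
   Context: All random variables are real-valued. A random field is wide-sense stationary if it has finite second moments, constant mean, and $\operatorname{cov}(X_{i,j},X_{i-h_1,j-h_2})$ depends only on $(h_1,h_2)$; its autocovariance function is $\gamma_X(h_1,h_2)=\operatorname{cov}(X_{i,j},X_{i-h_1,j-h_2})$. *)

(* Defs.v *)
From mathcomp Require Import all_boot all_order all_algebra.
From mathcomp Require Import all_classical all_reals all_analysis.

Set Implicit Arguments.
Unset Strict Implicit.
Unset Printing Implicit Defensive.

Import Order.TTheory GRing.Theory Num.Theory.
Local Open Scope ring_scope.

Section random_fields.
Context {d : measure_display} {T : measurableType d} {R : realType}
        (P : probability T R).
Implicit Types X eps : int -> int -> {RV P >-> R}.

Record white_noise eps (sigma2 : R) : Prop := WhiteNoise {
  white_noise_L2 : forall i j, (eps i j : T -> R) \in Lfun P 2%:E ;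
  white_noise_mean : forall i j, ('E_P[eps i j] = 0)%E ;
  white_noise_variance : forall i j, ('V_P[eps i j] = sigma2%:E)%E ;
  white_noise_uncorrelated : forall i j k l, (i, j) <> (k, l) ->
    covariance P (eps i j) (eps k l) = 0%E }.

Record wide_sense_stationary X : Prop := WideSenseStationary {
  wss_L2 : forall i j, (X i j : T -> R) \in Lfun P 2%:E ;
  wss_mean : forall i j k l, ('E_P[X i j] = 'E_P[X k l])%E ;
  wss_covariance : forall h1 h2 i j k l,
    covariance P (X i j) (X (i - h1) (j - h2)) =
    covariance P (X k l) (X (k - h1) (l - h2)) }.

(* Evaluated at the base point (0, 0); [autocovarianceE] shows that any base
   point may be used, and that [fine] loses nothing, for a stationary field. *)
Definition autocovariance X (h1 h2 : int) : R :=
  fine (covariance P (X 0 0) (X (0 - h1) (0 - h2))).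

Lemma autocovarianceE X : wide_sense_stationary X -> forall h1 h2 i j : int,
  covariance P (X i j) (X (i - h1) (j - h2)) = (autocovariance X h1 h2)%:E.
Proof.
move=> [X2 _ Xcov] h1 h2 i j.
rewrite (Xcov h1 h2 i j 0 0) /autocovariance fineK//.
have P1 : P setT \is a fin_num by rewrite probability_setT.
by apply: covariance_fin_num;
  [exact: (Lfun_subset12 P1) | exact: (Lfun_subset12 P1) | exact: Lfun2_mul_Lfun1].
Qed.

(* Equality of random variables is almost sure. *)
Definition satisfies_AR (a b c : R) eps X : Prop :=
  forall i j : int, {ae P, forall w,
    X i j w = a * X (i - 1) j w + b * X i (j - 1) w
              + c * X (i - 1) (j - 1) w + eps i j w}.

End random_fields.

(* Main.v *)
(* For h = (h1, h2) let D h be the defect of the asserted equality. The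
   autoregression gives D h = cov(eps_h, X_0), so D is square summable by Bessel's
   inequality; expanding X_0 instead of eps_h gives, for h <> 0,
     D(h1, h2) - b D(h1, h2 + 1) = a D(h1 + 1, h2) + c D(h1 + 1, h2 + 1).
   Up to a reflection or a swap of the coordinates, all four cases have the form
     p u_k(j) + q u_k(j + 1) = r u_{k+1}(j) + s u_{k+1}(j + 1),   k >= 0,
   where the two products in the hypothesis say that
     dl := p^2 + q^2 - r^2 - s^2 - 2 |pq - rs| > 0,
   i.e. |p + qz| > |r + sz| on the unit circle. With C := q^2 - s^2 - |pq - rs| and
   m_k(j) := (r u_k(j) + s u_k(j + 1))^2 this yields
     m_{k+1}(j) - m_k(j) >= dl u_k(j)^2 + C (u_k(j + 1)^2 - u_k(j)^2).
   Since m_k -> 0, summing over k gives (dl - C) E(j) + C E(j + 1) <= 0 for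
   E(j) := sum_k u_k(j)^2. So E is monotone on Z, and summable, hence zero. *)

Require Import Defs.
From mathcomp Require Import all_boot all_order all_algebra.
From mathcomp Require Import all_classical all_reals all_analysis.
From mathcomp Require Import measurable_realfun ring lra zify.

Set Implicit Arguments.
Unset Strict Implicit.
Unset Printing Implicit Defensive.

Import Order.TTheory GRing.Theory Num.Theory.
Import numFieldNormedType.Exports.
Local Open Scope ring_scope.

(** * Covariance as a bilinear form on square-integrable functions; Bessel's inequality *)

Section covariance_form.
Context (d : measure_display) (T : measurableType d) (R : realType)
        (P : probability T R).
Implicit Types f g h : T -> R.

Local Notation cov f g := (fine (covariance P f g)).

Lemma covariance_Lfun2_fin_num f g : f \in Lfun P 2%:E -> g \in Lfun P 2%:E ->
  covariance P f g \is a fin_num.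
Proof.
move=> f2 g2; have P1 : P setT \is a fin_num by rewrite probability_setT.
by apply: covariance_fin_num;
  [exact: (Lfun_subset12 P1) | exact: (Lfun_subset12 P1) | exact: Lfun2_mul_Lfun1].
Qed.

Lemma Lfun2_scale (t : R) f : f \in Lfun P 2%:E -> (t \o* f) \in Lfun P 2%:E.
Proof. by move=> f2; apply: Lfun_scale => //; rewrite ler1n. Qed.

Lemma Lfun2_add f g :
  f \in Lfun P 2%:E -> g \in Lfun P 2%:E -> (f \+ g) \in Lfun P 2%:E.
Proof. by move=> f2 g2; rewrite rpredD ?lee1n. Qed.

Lemma fine_covarianceDl f g h :
  f \in Lfun P 2%:E -> g \in Lfun P 2%:E -> h \in Lfun P 2%:E ->
  cov (f \+ g) h = cov f h + cov g h.
Proof.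
by move=> f2 g2 h2; rewrite covarianceDl// fineD// covariance_Lfun2_fin_num.
Qed.

Lemma fine_covarianceZl (t : R) f g :
  f \in Lfun P 2%:E -> g \in Lfun P 2%:E -> cov (t \o* f) g = t * cov f g.
Proof.
move=> f2 g2; have P1 : P setT \is a fin_num by rewrite probability_setT.
rewrite covarianceZl ?fineM ?covariance_Lfun2_fin_num//.
- exact: (Lfun_subset12 P1).
- exact: (Lfun_subset12 P1).
- exact: Lfun2_mul_Lfun1.
Qed.

Lemma eq_ae_expectation f g : measurable_fun setT f -> measurable_fun setT g ->
  {ae P, forall w, f w = g w} -> ('E_P[f] = 'E_P[g])%E.
Proof.
move=> mf mg fg; rewrite unlock; apply: ae_eq_integral => //.
- exact/measurable_EFinP.
- exact/measurable_EFinP.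
- by apply: filterS fg => w /= -> _.
Qed.

(** Needed because the autoregression holds only almost surely. *)
Lemma eq_ae_covariancel f g h : measurable_fun setT f -> measurable_fun setT g ->
    measurable_fun setT h -> {ae P, forall w, f w = g w} ->
  covariance P f h = covariance P g h.
Proof.
move=> mf mg mh fg; rewrite unlock (eq_ae_expectation mf mg fg).
apply: eq_ae_expectation.
- by apply: measurable_funM; apply: measurable_funB.
- by apply: measurable_funM; apply: measurable_funB.
- by apply: filterS fg => w fgw; rewrite !fctE /= fgw.
Qed.

(** Induction on [s]: removing from [f] its projection on [e i] leaves the covariances with the
    other [e j] unchanged and lowers [v * cov f f] by exactly [cov (e i) f ^+ 2]. *)
Lemma bessel_inequality (I : eqType) (e : I -> T -> R) (v : R) f (s : seq I) :
    0 < v -> (forall i, e i \in Lfun P 2%:E) ->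
    (forall i, cov (e i) (e i) = v) ->
    (forall i j, i != j -> cov (e i) (e j) = 0) ->
    f \in Lfun P 2%:E -> uniq s ->
  \sum_(i <- s) cov (e i) f ^+ 2 <= v * cov f f.
Proof.
move=> v0 e2 evar eorth; elim: s f => [|i s IHs] f f2 /=.
  by move=> _; rewrite big_nil; apply: mulr_ge0 (ltW v0) _; exact/fine_ge0/variance_ge0.
case/andP=> nis us; rewrite big_cons.
pose t : R := - (cov (e i) f / v).
pose f' := f \+ (t \o* e i).
have te2 : (t \o* e i) \in Lfun P 2%:E by exact: Lfun2_scale.
have f'2 : f' \in Lfun P 2%:E by exact: Lfun2_add.
have covf' h : h \in Lfun P 2%:E -> cov f' h = cov f h + t * cov (e i) h.
  by move=> h2; rewrite fine_covarianceDl// fine_covarianceZl.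
have <- : \sum_(j <- s) cov (e j) f' ^+ 2 = \sum_(j <- s) cov (e j) f ^+ 2.
  rewrite !big_seq; apply: eq_bigr => j js; congr (_ ^+ 2).
  rewrite covarianceC covf'// eorth ?mulr0 ?addr0 1?covarianceC//.
  by apply: contraNneq nis => ->.
have -> : v * cov f f = cov (e i) f ^+ 2 + v * cov f' f'.
  rewrite covf'// (covarianceC P f f') (covarianceC P (e i) f') !covf'// evar.
  by rewrite (covarianceC P f (e i)) /t; field; rewrite gt_eqF.
by rewrite lerD2l IHs.
Qed.

End covariance_form.

(** * Square-summable solutions of linear recurrences *)

Section transport.
Local Open Scope classical_set_scope.
Context (R : realType).

Lemma summable_nondecreasing_le0 (E : nat -> R) (S : R) :
    {homo E : m n / (m <= n)%N >-> m <= n} ->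
    (forall n, \sum_(i < n) E i <= S) -> E 0%N <= 0.
Proof.
move=> ndE ES; rewrite leNgt; apply/negP => E0.
have H n : E 0%N *+ n <= S.
  apply: le_trans (ES n); rewrite -[X in _ *+ X]card_ord -sumr_const.
  by apply: ler_sum => i _; apply: ndE.
have S0 : 0 <= S by have := H 0%N; rewrite mulr0n.
have := archi_boundP (divr_ge0 S0 (ltW E0)).
rewrite ltr_pdivrMr// mulrC mulr_natr => /lt_le_trans/(_ (H _)).
by rewrite ltxx.
Qed.

(** With D = pq - rs, right side minus left side is |D| (u + u')^2 if D >= 0 and |D| (u - u')^2
    otherwise. *)
Lemma transport_energy (p q r s u u' v v' : R) :
  p * u + q * u' = r * v + s * v' ->
  (p ^+ 2 + q ^+ 2 - r ^+ 2 - s ^+ 2 - 2 * `|p * q - r * s|) * u ^+ 2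
    + (q ^+ 2 - s ^+ 2 - `|p * q - r * s|) * (u' ^+ 2 - u ^+ 2)
  <= (r * v + s * v') ^+ 2 - (r * u + s * u') ^+ 2.
Proof.
move=> <-; rewrite -subr_ge0; set D := p * q - r * s.
have -> : (p * u + q * u') ^+ 2 - (r * u + s * u') ^+ 2
    - ((p ^+ 2 + q ^+ 2 - r ^+ 2 - s ^+ 2 - 2 * `|D|) * u ^+ 2
       + (q ^+ 2 - s ^+ 2 - `|D|) * (u' ^+ 2 - u ^+ 2))
  = `|D| * (u ^+ 2 + u' ^+ 2) + D * (2 * (u * u')) by rewrite /D; ring.
have [D0|D0] := ger0P D.
- by rewrite -mulrDr mulr_ge0//; have := sqr_ge0 (u + u'); nra.
- by rewrite mulNr addrC -mulrBr mulr_le0 ?(ltW D0)//; have := sqr_ge0 (u - u'); nra.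
Qed.

Lemma square_summable_transport0 (p q r s S : R) (u : nat -> int -> R) :
    2 * `|p * q - r * s| < p ^+ 2 + q ^+ 2 - r ^+ 2 - s ^+ 2 ->
    (forall k j, p * u k j + q * u k (j + 1)
                 = r * u k.+1 j + s * u k.+1 (j + 1)) ->
    (forall t : seq (nat * int), uniq t ->
      \sum_(x <- t) u x.1 x.2 ^+ 2 <= S) ->
  forall k j, u k j = 0.
Proof.
move=> pqrs u_rec u_sum.
pose dl := p ^+ 2 + q ^+ 2 - r ^+ 2 - s ^+ 2 - 2 * `|p * q - r * s|.
have dl0 : 0 < dl by rewrite subr_gt0.
pose C := q ^+ 2 - s ^+ 2 - `|p * q - r * s|.
pose e j := series (fun k => u k j ^+ 2).
(* Sums over finite rectangles: a single [j] gives convergence of [e j], a general [t] gives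
   summability of the limits [E]. *)
have box K (t : seq int) : uniq t -> \sum_(j <- t) e j K <= S.
  move=> ut; pose tK := [seq (k, j) | j <- t, k <- iota 0 K].
  have utK : uniq tK.
    apply: allpairs_uniq => //; first exact: iota_uniq.
    by move=> [? ?] [? ?] _ _ [-> ->].
  apply: le_trans (u_sum _ utK); rewrite big_allpairs_dep /=.
  by under eq_bigr do rewrite /e /series /= /index_iota subn0.
have e_nd j : nondecreasing_seq (e j).
  by apply: nondecreasing_series => k _ _; exact: sqr_ge0.
have e_cvg j : cvgn (e j).
  apply: nondecreasing_is_cvgn => //; exists S => _ [K _ <-].
  by have := box K [:: j] isT; rewrite big_seq1.
pose E j := limn (e j).
have E_ge k j : u k j ^+ 2 <= E j.
  apply: le_trans (nondecreasing_cvgn_le (e_nd j) (e_cvg j) k.+1).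
  by rewrite /e /series /= big_nat_recr //= lerDr sumr_ge0 // => i _; exact: sqr_ge0.
have E0 j : 0 <= E j by apply: le_trans (E_ge 0%N j); exact: sqr_ge0.
have E_sum (t : seq int) : uniq t -> \sum_(j <- t) E j <= S.
  move=> ut; have : (fun K => \sum_(j <- t) e j K) @ \oo --> \sum_(j <- t) E j.
    by apply: cvg_big => [|j _]; [exact: add_continuous|exact: e_cvg].
  by move=> /cvgr_to_le; apply; apply: nearW => K; exact: box.
have u2_cvg0 j : (fun k => u k j ^+ 2) @ \oo --> 0.
  exact: (@cvg_series_cvg_0 _ R^o _ (e_cvg j)).
have E_rec j : (dl - C) * E j + C * E (j + 1) <= 0.
  pose m k := (r * u k j + s * u k (j + 1)) ^+ 2.
  (* Since (x + y)^2 <= 2 x^2 + 2 y^2, [m'] dominates [m]; it involves only the squares of [u],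
     already known to tend to 0. *)
  pose m' k := 2 * r ^+ 2 * u k j ^+ 2 + 2 * s ^+ 2 * u k (j + 1) ^+ 2.
  have le_m K : dl * e j K + C * (e (j + 1) K - e j K) <= m' K.
    apply: (@le_trans _ _ (m K - m 0%N)); last first.
      have := sqr_ge0 (r * u K j - s * u K (j + 1)).
      by have := sqr_ge0 (r * u 0%N j + s * u 0%N (j + 1)); rewrite /m /m'; nra.
    rewrite -(telescope_sumr _ (leq0n K)) /e /series /= -sumrB !mulr_sumr.
    rewrite -big_split /=; apply: ler_sum => k _.
    exact: transport_energy.
  have m'0 : m' @ \oo --> 0.
    have -> : 0 = 2 * r ^+ 2 * 0 + 2 * s ^+ 2 * 0 :> R by ring.
    by apply: cvgD; apply: cvgM => //; exact: cvg_cst.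
  have -> : (dl - C) * E j + C * E (j + 1) = dl * E j + C * (E (j + 1) - E j) by ring.
  have L : (fun K => dl * e j K + C * (e (j + 1) K - e j K)) @ \oo
      --> dl * E j + C * (E (j + 1) - E j).
    by apply: cvgD; apply: cvgMl_tmp; [exact: e_cvg|apply: cvgB; exact: e_cvg].
  by apply: ler_cvg_to L m'0 _; apply: nearW.
suff E_le0 j : E j <= 0.
  move=> k j; apply/eqP; rewrite -sqrf_eq0 eq_le sqr_ge0 andbT.
  exact: le_trans (E_ge k j) _.
have E_line (sg : int) : sg != 0 -> forall n, \sum_(i < n) E (j + sg * i%:Z) <= S.
  move=> sg0 n; pose t := [seq j + sg * i%:Z | i <- iota 0 n].
  have ut : uniq t.
    by rewrite map_inj_uniq ?iota_uniq// => x y /addrI/(mulfI sg0)[].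
  apply: le_trans (E_sum _ ut).
  rewrite big_map -(big_mkord xpredT (fun i : nat => E (j + sg * i%:Z))).
  by rewrite /index_iota subn0.
(* By [E_rec], E is nondecreasing if C <= 0 and nonincreasing otherwise. *)
have [C0|C0] := lerP C 0.
- have := @summable_nondecreasing_le0 (fun i => E (j + 1 * i%:Z)) S.
  rewrite mulr0 addr0; apply; last exact: E_line.
  apply/nondecreasing_seqP => n; set j' := j + 1 * n%:Z.
  have -> : j + 1 * n.+1%:Z = j' + 1 by rewrite /j'; lia.
  (* (dl - C) E(j') <= -C E(j' + 1) <= (dl - C) E(j' + 1), as dl > 0; divide by dl - C > 0. *)
  by have := E_rec j'; have := E0 j'; have := E0 (j' + 1); nra.
- have := @summable_nondecreasing_le0 (fun i => E (j + -1 * i%:Z)) S.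
  rewrite mulr0 addr0; apply; last exact: E_line.
  apply/nondecreasing_seqP => n; set j' := j + -1 * n.+1%:Z.
  have -> : j + -1 * n%:Z = j' + 1 by rewrite /j'; lia.
  by have := E_rec j'; have := E0 j'; have := E0 (j' + 1); nra.
Qed.

End transport.

(** Stated for an abstract [D] so that it also applies with the coordinates swapped. The recurrence
    may fail at the origin, so each half-plane is swept in a direction that avoids using it
    there. *)
Lemma square_summable_recurrence0 (R : realType) (a b c S : R)
    (D : int -> int -> R) (h1 h2 : int) :
    (forall i j : int, (i, j) <> (0, 0) ->
      D i j = a * D (i + 1) j + b * D i (j + 1) + c * D (i + 1) (j + 1)) ->
    (forall t : seq (int * int), uniq t -> \sum_(x <- t) D x.1 x.2 ^+ 2 <= S) ->
    [/\ 1 <= h1, 0 < (1 - a - b - c) * (1 + a - b + c)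
      & 0 < (1 - a + b + c) * (1 + a + b - c)] \/
    [/\ h1 <= 0, (1 - a - b - c) * (1 + a - b + c) < 0
      & (1 - a + b + c) * (1 + a + b - c) < 0] ->
  D h1 h2 = 0.
Proof.
move=> D_rec D_sum.
have D_sum_comp (f : nat * int -> int * int) : injective f ->
    forall t, uniq t -> \sum_(x <- t) D (f x).1 (f x).2 ^+ 2 <= S.
  move=> f_inj t ut.
  by rewrite -(big_map f xpredT (fun x => D x.1 x.2 ^+ 2)) D_sum ?map_inj_uniq.
case=> -[h1_half cond1 cond2].
- have [k ->] : exists k : nat, h1 = 1 + k%:Z by exists `|h1 - 1|%N; lia.
  pose u (k : nat) j := D (1 + k%:Z) j.
  rewrite -/(u k h2); apply: (@square_summable_transport0 R 1 (- b) a c S).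
  (* The two products are (p + q)^2 - (r + s)^2 and (p - q)^2 - (r - s)^2, that is, p^2 + q^2 - r^2
     - s^2 plus or minus 2 (pq - rs). In the reflected case below they are the negatives of
     these. *)
  + by rewrite -ltr_pdivlMl// ltr_norml; apply/andP; split; nra.
  + move=> {}k j; rewrite /u D_rec; last by case; lia.
    have -> : 1 + k.+1%:Z = 1 + k%:Z + 1 by lia.
    by ring.
  + apply: (D_sum_comp (fun x => (1 + x.1%:Z, x.2))).
    by move=> [x1 x2] [y1 y2] /= [E1 ->]; congr pair; lia.
- (* Reflecting both coordinates exchanges the two sides of the recurrence. *)
  have [k ->] : exists k : nat, h1 = - k%:Z by exists `|h1|%N; lia.
  have -> : h2 = - (- h2) by rewrite opprK.
  pose u (k : nat) j := D (- k%:Z) (- j).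
  rewrite -/(u k (- h2)); apply: (@square_summable_transport0 R c a (- b) 1 S).
  + by rewrite -ltr_pdivlMl// ltr_norml; apply/andP; split; nra.
  (* The recurrence is used at first coordinate -(k + 1) < 0, off the origin, yet it still reaches
     column 0; hence [h1 <= 0] here against [1 <= h1] above. *)
  + move=> {}k j; rewrite /u (D_rec (- k.+1%:Z) (- (j + 1))); last by case; lia.
    have -> : - k.+1%:Z + 1 = - k%:Z by lia.
    have -> : - (j + 1) + 1 = - j by lia.
    by ring.
  + apply: (D_sum_comp (fun x => (- x.1%:Z, - x.2))).
    by move=> [x1 x2] [y1 y2] /= [E1 E2]; congr pair; lia.
Qed.

(** * Application to the autocovariances *)

Theorem lemma2 (d : measure_display) (T : measurableType d) (R : realType)
    (P : probability T R) (a b c sigma2 : R)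
    (eps X : int -> int -> {RV P >-> R})
    (sigma2_gt0 : 0 < sigma2)
    (eps_noise : white_noise eps sigma2)
    (X_stationary : wide_sense_stationary X)
    (X_AR : satisfies_AR a b c eps X)
    (h1 h2 : int) :
  [\/ [/\ 1 <= h1,
          0 < (1 - a - b - c) * (1 + a - b + c)
        & 0 < (1 - a + b + c) * (1 + a + b - c)],
      [/\ h1 <= 0,
          (1 - a - b - c) * (1 + a - b + c) < 0
        & (1 - a + b + c) * (1 + a + b - c) < 0],
      [/\ 1 <= h2,
          0 < (1 - a - b - c) * (1 - a + b + c)
        & 0 < (1 + a - b + c) * (1 + a + b - c)]
    | [/\ h2 <= 0,
          (1 - a - b - c) * (1 - a + b + c) < 0
        & (1 + a - b + c) * (1 + a + b - c) < 0]] ->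
  autocovariance X h1 h2 =
    a * autocovariance X (h1 - 1) h2
    + b * autocovariance X h1 (h2 - 1)
    + c * autocovariance X (h1 - 1) (h2 - 1).
Proof.
case: eps_noise => eps2 _ eps_var eps_orth.
have X2 := wss_L2 X_stationary.
pose gam := autocovariance X.
pose D i j := gam i j - (a * gam (i - 1) j + b * gam i (j - 1) + c * gam (i - 1) (j - 1)).
(* Used twice: [f] in the field identifies [D] with a noise-field covariance, [f] in the noise gives
   the recurrence for [D]. *)
have cov_AR i j (f : T -> R) : f \in Lfun P 2%:E ->
    fine (covariance P (X i j) f) = a * fine (covariance P (X (i - 1) j) f)
      + b * fine (covariance P (X i (j - 1)) f)
      + c * fine (covariance P (X (i - 1) (j - 1)) f)
      + fine (covariance P (eps i j) f).
  move=> f2.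
  have sX2 t k l := Lfun2_scale t (X2 k l).
  have Lfun_meas g : g \in Lfun P 2%:E -> measurable_fun setT g.
    by move=> /sub_Lfun_mfun; rewrite inE.
  rewrite -!fine_covarianceZl// -!fine_covarianceDl ?Lfun2_add//.
  congr fine; apply: eq_ae_covariancel; [exact: Lfun_meas| |exact: Lfun_meas|].
    by apply: Lfun_meas; rewrite !Lfun2_add.
  by apply: filterS (X_AR i j) => w /= ->; ring.
have cov_X i j k l : fine (covariance P (X i j) (X k l)) = gam (i - k) (j - l).
  by have := autocovarianceE X_stationary (i - k) (j - l) i j; rewrite !subKr => ->.
have cov_eps i j k l : fine (covariance P (eps i j) (X k l)) = D (i - k) (j - l).
  have := cov_AR i j _ (X2 k l); rewrite !cov_X /D -![_ - 1 - _]addrAC => ->.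
  by rewrite [X in X - _]addrC addrK.
have D_rec (i j : int) : (i, j) <> (0, 0) ->
    D i j = a * D (i + 1) j + b * D i (j + 1) + c * D (i + 1) (j + 1).
  move=> ij0; have := cov_AR 0 0 _ (eps2 i j); rewrite !(covarianceC P _ (eps i j)).
  by rewrite !cov_eps eps_orth// !sub0r !opprK !subr0 addr0.
have D_sum (t : seq (int * int)) : uniq t ->
    \sum_(x <- t) D x.1 x.2 ^+ 2 <= sigma2 * gam 0 0.
  move=> ut.
  have := @bessel_inequality _ _ _ P _ (fun x => eps x.1 x.2 : T -> R) sigma2
    (X 0 0) t sigma2_gt0 _ _ _ (X2 0 0) ut.
  rewrite cov_X; under eq_bigr do rewrite cov_eps !subr0.
  apply.
  - by move=> x; exact: eps2.
  - by move=> x; rewrite [covariance _ _ _]eps_var.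
  - by move=> [x1 x2] [y1 y2] /eqP xy; rewrite eps_orth.
(* Swapping the coordinates exchanges [a] and [b], which turns the first two conditions into the
   last two. *)
have D_rec' (i j : int) : (i, j) <> (0, 0) ->
    D j i = b * D j (i + 1) + a * D (j + 1) i + c * D (j + 1) (i + 1).
  by move=> ij0; rewrite D_rec ?[b * _ + _]addrC// => -[j0 i0]; apply: ij0; rewrite i0 j0.
have D_sum' (t : seq (int * int)) : uniq t ->
    \sum_(x <- t) D x.2 x.1 ^+ 2 <= sigma2 * gam 0 0.
  move=> ut; pose sw (x : int * int) := (x.2, x.1).
  rewrite -(big_map sw xpredT (fun x => D x.1 x.2 ^+ 2)) D_sum// map_inj_uniq//.
  by move=> [x1 x2] [y1 y2] [-> ->].
move=> cond; apply: subr0_eq; rewrite -/(D h1 h2).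
case: cond => cond.
- by apply: (square_summable_recurrence0 _ D_rec D_sum); left.
- by apply: (square_summable_recurrence0 _ D_rec D_sum); right.
- apply: (square_summable_recurrence0 (D := fun i j => D j i) _ D_rec' D_sum').
  by case: cond => ? ? ?; left; split => //; nra.
- apply: (square_summable_recurrence0 (D := fun i j => D j i) _ D_rec' D_sum').
  by case: cond => ? ? ?; right; split => //; nra.
Qed.
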